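(* Let $P_0,P_1$ be probability measures on a measurable space with $P_1\ll P_0$, $\mathrm{KL}(P_1\|P_0)<\infty$ and $\mathrm{KL}(P_0\|P_1)<\infty$, and let $R=\frac{dP_1}{dP_0}$. Then $$\Lambda(R)\ =\ \sup_{\beta\in(0,1]}\beta\,\lambda(\beta)\ =\ -\inf_{\beta\in(0,1]}\log Z_\beta\ =\ C(P_0,P_1),$$ the Chernoff information of the pair. Moreover, if $\log R$ is not $P_0$-a.s. constant then $\Lambda(R_\beta)>\lambda(\beta)$ strictly, for every $\beta\in(0,1]$.
   Context: For $\beta\in(0,1]$: $Z_\beta:=\mathbb E_{P_0}[R^\beta]$, $\lambda(\beta):=-\frac1\beta\log Z_\beta$, $R_\beta:=R^\beta/Z_\beta$. For a measurable $E$ with values in $[0,\infty]$ and $\mathbb E_{P_0}[E]\le1$: $\Lambda(E):=\sup_{s\ge0}\{-\log\mathbb E_{P_1}[E^{-s}]\}$. The Chernoff information is $C(P_0,P_1):=-\inf_{\beta\in[0,1]}\log\int p_0^{1-\beta}p_1^{\beta}\,d\mu$, with $p_i$ the density of $P_i$ with respect to a common dominating measure $\mu$. Conventions: $x^0=1$; for $s>0$, $0^{-s}=+\infty$, $(+\infty)^{-s}=0$; $\log(+\infty)=+\infty$. *)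

(* Defs.v *)
From HB Require Import structures.
From mathcomp Require Import all_boot all_order all_algebra.
From mathcomp Require Import all_classical all_reals all_analysis.
From mathcomp Require Import measurable_realfun.

Set Implicit Arguments.
Unset Strict Implicit.
Unset Printing Implicit Defensive.

Import Order.TTheory GRing.Theory Num.Theory.
Import numFieldNormedType.Exports.

Local Open Scope classical_set_scope.
Local Open Scope ring_scope.
Local Open Scope ereal_scope.

Section densities.
Context {d : measure_display} {T : measurableType d} {R : realType}.

(* [f] is a version, with values in [0, +oo], of the Radon-Nikodym derivative
   of [nu] with respect to [mu]. *)
Definition is_density (mu nu : {measure set T -> \bar R}) (f : T -> \bar R) :=
  [/\ measurable_fun [set: T] f,
      forall x, 0 <= f x &
      forall A, measurable A -> nu A = \int[mu]_(x in A) f x].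

Lemma is_density_Radon_Nikodym (mu : {sigma_finite_measure set T -> \bar R})
    (nu : {finite_measure set T -> \bar R}) :
  nu `<< mu -> is_density mu nu (Radon_Nikodym_SigmaFinite.f nu mu).
Proof.
move=> numu; split.
- exact: measurable_int (Radon_Nikodym_SigmaFinite.f_integrable numu).
- exact: Radon_Nikodym_SigmaFinite.f_ge0.
- by move=> A mA; exact: Radon_Nikodym_SigmaFinite.f_integral.
Qed.

(* KL(P || Q), equal to +oo when P is not absolutely continuous w.r.t. Q. *)
Definition KL (P Q : probability T R) : \bar R :=
  if `[< P `<< Q >]
  then \int[P]_x lne (Radon_Nikodym_SigmaFinite.f P Q x)
  else +oo.

(* Intended for densities [p0], [p1] with respect to a common dominating
   measure [mu]; the library has x `^ 0 = 1, also at x = 0 and x = +oo. *)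
Definition chernoff_information (mu : {measure set T -> \bar R})
    (p0 p1 : T -> \bar R) : \bar R :=
  - ereal_inf
      [set lne (\int[mu]_x (p0 x `^ (1 - b) * p1 x `^ b)) | b in `[0%R, 1%R]].

End densities.

Section evalues.
Context {d : measure_display} {T : measurableType d} {R : realType}.

(* x^(-s) for s >= 0 and x in [0, +oo].  The extended inverse satisfies
   0^-1 = +oo and (+oo)^-1 = 0, so that 0^(-s) = +oo and (+oo)^(-s) = 0 for
   s > 0; the library's [x `^ (- s)] would give 0 and +oo instead. *)
Definition npow (x : \bar R) (s : R) : \bar R := (x `^ s)^-1.

(* Intended for measurable [E] with values in [0, +oo] whose expectation under
   the null hypothesis is at most 1; the formula itself only involves P1. *)
Definition Lambda (P1 : probability T R) (E : T -> \bar R) : \bar R :=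
  ereal_sup [set - lne (\int[P1]_x npow (E x) s) | s in `[0%R, +oo[].

(* In what follows [r] stands for the likelihood ratio dP1/dP0. *)
Definition Z (P0 : probability T R) (r : T -> \bar R) (b : R) : \bar R :=
  \int[P0]_x (r x `^ b).

Definition lambda (P0 : probability T R) (r : T -> \bar R) (b : R) : \bar R :=
  - ((b^-1)%:E * lne (Z P0 r b)).

(* R_b = R^b / Z_b. *)
Definition tempered (P0 : probability T R) (r : T -> \bar R) (b : R)
    : T -> \bar R :=
  fun x => r x `^ b / Z P0 r b.

End evalues.

(* Main.v *)
Require Import Defs.
From HB Require Import structures.
From mathcomp Require Import all_boot all_order all_algebra.
From mathcomp Require Import all_classical all_reals all_analysis.
From mathcomp Require Import measurable_realfun.
From mathcomp Require Import ring lra.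

Set Implicit Arguments.
Unset Strict Implicit.
Unset Printing Implicit Defensive.

Import Order.TTheory GRing.Theory Num.Theory.
Import numFieldNormedType.Exports.

Local Open Scope classical_set_scope.
Local Open Scope ring_scope.
Local Open Scope ereal_scope.

(* KL(P0 || P1) < +oo forces P0 << P1, which makes R positive and finite
   almost surely, so that R may be replaced by a real-valued positive version. A change of measure then gives
   E_P1[R^-s] = Z_(1-s). For s < 1 this is the substitution beta = 1 - s; for
   s >= 1 it is at least 1 by Bernoulli's inequality, so such s contribute
   nothing beyond -log Z_1 = 0. For the Chernoff information, p1 = R p0 holds
   mu-almost everywhere, hence the integrand is R^beta p0 when beta > 0, while
   beta = 0 gives the same value as beta = 1. The strict inequality amounts to
   Z_(b/2)^2 < Z_b, i.e. to R^(b/2) having positive variance under P0. *)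

(** * Change of measure through a density *)

Section density.
Context {d : measure_display} {T : measurableType d} {R : realType}.
Implicit Types mu nu : {measure set T -> \bar R}.

Import HBNNSimple.

(** By linearity over the finitely many level sets of [h]: on each of them the claim is the defining
    property of a density. *)
Lemma nnsfun_integral_density mu nu (f : T -> \bar R) (h : {nnsfun T >-> R}) :
  is_density mu nu f ->
  \int[nu]_x (h x)%:E = \int[mu]_x ((h x)%:E * f x).
Proof.
move=> [mf f0 nuE].
have hE x : (h x)%:E * f x =
    \sum_(y \in range h) (y%:E * ((\1_(h @^-1` [set y]) x)%:E * f x)).
  rewrite [X in X%:E * _](fimfunE h) -fsumEFin// ge0_mule_fsuml.
    by apply: eq_fsbigr => y _; rewrite EFinM muleA.
  by move=> y; exact: nnfun_muleindic_ge0.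
under [RHS]eq_integral do rewrite hE.
have mh y : measurable (h @^-1` [set y]) by exact: measurable_funPTI.
have mg y : measurable_fun setT (fun x => (\1_(h @^-1` [set y]) x)%:E * f x).
  by apply: emeasurable_funM => //; exact/measurable_EFinP.
rewrite ge0_integral_fsum//; last 2 first.
- by move=> y; exact: measurable_funeM.
- move=> y x _; rewrite muleA mule_ge0//.
  exact: nnfun_muleindic_ge0.
rewrite integralT_nnsfun sintegralE; apply: eq_fsbigr => y.
rewrite inE => -[t _ <-]; rewrite ge0_integralZl ?lee_fin//; last first.
  by move=> x _; rewrite mule_ge0// lee_fin.
rewrite nuE// integral_mkcond; congr (_ * _).
by apply: eq_integral => x _; rewrite epatch_indic muleC.
Qed.

(** Monotone convergence on both sides, along simple functions increasing to [g]. *)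
Lemma ge0_integral_density mu nu (f g : T -> \bar R) :
  is_density mu nu f -> measurable_fun [set: T] g -> (forall x, 0 <= g x) ->
  \int[nu]_x g x = \int[mu]_x (g x * f x).
Proof.
move=> nuf mg g0; have [mf f0 _] := nuf.
pose h := nnsfun_approx measurableT mg.
have h_nd x : {homo (fun n => (h n x)%:E) : n m / (n <= m)%N >-> n <= m}.
  by move=> n m nm; rewrite lee_fin; exact/lefP/nd_nnsfun_approx.
have hg x : (h n x)%:E @[n --> \oo] --> g x.
  by apply: (cvg_nnsfun_approx measurableT mg) => // ? _.
have hgf x : (h n x)%:E * f x @[n --> \oo] --> g x * f x.
  (* The limit of the product is delicate only when [g x] is 0 and [f x] may be +oo. There each
     [h n x] lies between 0 and the limit [g x], so the product is constantly 0. *)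
  have [gx0|gx0] := eqVneq (g x) 0; last first.
    have [fx|fx] := boolP (f x \is a fin_num); first exact: cvgeZr.
    apply: cvgeM; [|exact: hg|exact: cvg_cst].
    exact: mule_def_neq0_infty.
  have hx0 n : (h n x)%:E = 0.
    apply/eqP; rewrite eq_le; apply/andP; split; last by rewrite lee_fin.
    rewrite -gx0 -(cvg_lim (@ereal_hausdorff R) (hg x)).
    rewrite (cvg_lim (@ereal_hausdorff R) (ereal_nondecreasing_cvgn (h_nd x))).
    by apply: ereal_sup_ubound; exists n.
  rewrite gx0 mul0e (_ : (fun _ => _) = cst 0); first exact: cvg_cst.
  by apply/funext => n; rewrite hx0 mul0e.
transitivity (limn (fun n => \int[nu]_x (h n x)%:E)).
  rewrite -monotone_convergence//; last 2 first.
  - by move=> n; exact/measurable_EFinP.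
  - by move=> n x _; rewrite lee_fin.
  by apply: eq_integral => x _; apply/esym/cvg_lim => //; exact: hg.
transitivity (limn (fun n => \int[mu]_x ((h n x)%:E * f x))).
  by congr (limn _); apply/funext => n; exact: nnsfun_integral_density.
rewrite -monotone_convergence//.
- by apply: eq_integral => x _; apply/cvg_lim => //; exact: hgf.
- by move=> n; apply: emeasurable_funM => //; exact/measurable_EFinP.
- by move=> n x _; rewrite mule_ge0// lee_fin.
- by move=> x _ n m nm; rewrite lee_wpmul2r//; exact: h_nd.
Qed.

(** Chain rule for densities: change of measure applied to [f] restricted to [A]. *)
Lemma is_density_comp mu nu la (f g : T -> \bar R) :
  is_density nu la f -> is_density mu nu g ->
  is_density mu la (fun x => f x * g x).
Proof.
move=> [mf f0 laE] nug; have [mg g0 _] := nug.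
split; [exact: emeasurable_funM|by move=> x; rewrite mule_ge0|].
move=> A mA; rewrite laE// [LHS]integral_mkcond [RHS]integral_mkcond.
rewrite (ge0_integral_density nug); last 2 first.
- by apply/(measurable_restrictT _ _).1 => //; exact: measurable_funTS.
- by move=> x; rewrite patchE; case: ifP.
by apply: eq_integral => x _; rewrite !patchE; case: ifP => // _; rewrite mul0e.
Qed.

(** Finite total mass makes [f] integrable, and integrable functions with equal integrals over all
    measurable sets agree almost everywhere. *)
Lemma is_density_ae_unique mu nu (f g : T -> \bar R) : nu [set: T] < +oo ->
  is_density mu nu f -> is_density mu nu g -> ae_eq mu [set: T] f g.
Proof.
move=> nuT [mf f0 fE] [mg g0 gE]; apply: integral_ae_eq => //.
- apply/integrableP; split => //.
  under eq_integral do rewrite gee0_abs//.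
  by rewrite -fE.
- by move=> E _ mE; rewrite -fE// gE.
Qed.

Lemma is_density_ae_eq mu nu (f g : T -> \bar R) :
  is_density mu nu f -> measurable_fun [set: T] g -> (forall x, 0 <= g x) ->
  ae_eq mu [set: T] f g -> is_density mu nu g.
Proof.
move=> [mf f0 fE] mg g0 fg; split=> // A mA; rewrite fE//.
apply: ge0_ae_eq_integral => //; try exact: measurable_funTS.
by apply: ae_eq_subset fg.
Qed.

End density.

(** * Negative powers, almost-everywhere invariance, and a positive real version of R *)

Section npow.
Context {d : measure_display} {T : measurableType d} {R : realType}.

Lemma measurable_fun_poweR (g : T -> \bar R) (a : R) :
  measurable_fun [set: T] g -> measurable_fun [set: T] (fun x => g x `^ a).
Proof.
move=> mg; apply: (@measurableT_comp _ _ _ _ _ _ (poweR ^~ a)) => //.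
exact: measurable_poweR.
Qed.

Lemma npow_ge0 (x : \bar R) s : 0 <= npow x s.
Proof. by rewrite /npow inve_ge0 poweR_ge0. Qed.

Lemma npow_EFin (x s : R) : (0 < x)%R -> npow x%:E s = (x `^ (- s))%:E.
Proof.
by move=> x0; rewrite /npow poweR_EFin inver gt_eqF ?powR_gt0// powRN.
Qed.

Lemma measurable_npow (s : R) : measurable_fun [set: \bar R] (npow ^~ s).
Proof.
(* Only the value 0 of the power needs a separate case: at +oo, [fine] returns 0 and the real power
   0^(-1) is 0 by default, which agrees with (+oo)^-1 = 0. *)
have -> : npow ^~ s = fun x : \bar R =>
    if x `^ s == 0 then +oo else (fine (x `^ s) `^ (-1))%:E.
  apply/funext => x; rewrite /npow; have := poweR_ge0 x s.
  case: (x `^ s) => [y| |] //; last first.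
    by move=> _ /=; rewrite invey powR0// oppr_eq0 oner_eq0.
  by rewrite lee_fin inver eqe => y0; case: eqP => //= _; rewrite powR_inv1.
have mp : measurable_fun [set: \bar R] (fun x => x `^ s).
  exact: measurable_poweR.
apply: measurable_fun_ifT => //; first exact: measurable_fun_eqe.
apply/measurable_EFinP.
apply: (@measurableT_comp _ _ _ _ _ _ (fun y : R => y `^ (-1))%R).
  exact: measurable_powR.
exact: measurableT_comp.
Qed.

Lemma ae_eq_Lambda (P1 : probability T R) (E F : T -> \bar R) :
  measurable_fun [set: T] E -> measurable_fun [set: T] F ->
  ae_eq P1 [set: T] E F -> Lambda P1 E = Lambda P1 F.
Proof.
move=> mE mF EF; rewrite /Lambda; congr ereal_sup.
apply: eq_imagel => s _; congr (- lne _); apply: ge0_ae_eq_integral => //.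
- apply: (@measurableT_comp _ _ _ _ _ _ (npow ^~ s)) => //.
  exact: measurable_npow.
- apply: (@measurableT_comp _ _ _ _ _ _ (npow ^~ s)) => //.
  exact: measurable_npow.
- by move=> x _; exact: npow_ge0.
- by move=> x _; exact: npow_ge0.
- exact: (ae_eq_comp (npow ^~ s)).
Qed.

Lemma ae_eq_Z (P0 : probability T R) (f g : T -> \bar R) b :
  measurable_fun [set: T] f -> measurable_fun [set: T] g ->
  ae_eq P0 [set: T] f g -> Z P0 f b = Z P0 g b.
Proof.
move=> mf mg fg; apply: ge0_ae_eq_integral => //.
- exact: measurable_fun_poweR.
- exact: measurable_fun_poweR.
- by move=> x _; exact: poweR_ge0.
- by move=> x _; exact: poweR_ge0.
- exact: (ae_eq_comp (poweR ^~ b)).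
Qed.

Lemma KL_lty_dominates (P Q : probability T R) : KL P Q < +oo -> P `<< Q.
Proof. by rewrite /KL; case: asboolP => //; rewrite ltxx. Qed.

(** The set where [r] vanishes is P1-null, as the integral of [r] over it is 0, hence P0-null by
    domination. Integrability makes [r] finite P0-almost surely. On the remaining null set any
    positive value will do; 1 is chosen. *)
Lemma pos_density_version (P0 P1 : probability T R) (r : T -> \bar R) :
  P0 `<< P1 -> is_density P0 P1 r ->
  exists f : T -> R, [/\ measurable_fun [set: T] f, forall x, (0 < f x)%R &
    ae_eq P0 [set: T] r (EFin \o f)].
Proof.
move=> /null_content_dominatesP P01 [mr r0 rE].
exists (fun x => if (0 < r x) && (r x < +oo) then fine (r x) else 1%R).
have mlt : measurable_fun setT (fun x => (0 < r x) && (r x < +oo)).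
  by apply: measurable_and; exact: measurable_fun_lte.
split.
- by apply: measurable_fun_ifT => //; exact: measurableT_comp.
- by move=> x; case: ifPn => // rx; rewrite fine_gt0.
have ir : P0.-integrable setT r.
  apply/integrableP; split => //; under eq_integral do rewrite gee0_abs//.
  rewrite -rE// (le_lt_trans (@probability_le1 _ _ _ P1 _ measurableT))//.
  exact: ltry.
have mN : measurable (r @^-1` [set 0]).
  by rewrite -[X in measurable X]setTI; exact: mr.
have N0 : P0 (r @^-1` [set 0]) = 0.
  apply: P01 => //; apply: (etrans (rE _ mN)); exact: integral0_eq.
have r_neq0 : {ae P0, forall x, r x != 0}.
  by exists (r @^-1` [set 0]); split => // x /= /negP/negPn/eqP.
have := integrable_ae measurableT ir; move: r_neq0; apply: filterS2 => x rx0.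
move=> /(_ I) rx _; rewrite /= lt_neqAle eq_sym rx0 r0 ltey_eq rx/= fineK//.
Qed.
End npow.

(** Strict Jensen inequality for the square: z - m^2 is the variance of [X], and zero variance would
    make [X] almost surely equal to its mean. *)
Lemma sqr_mean_lt {d : measure_display} {T : measurableType d} {R : realType}
    (P : probability T R) (X : T -> R) (m z : R) :
  measurable_fun [set: T] X -> (forall x, (0 <= X x)%R) ->
  \int[P]_x (X x)%:E = m%:E -> \int[P]_x (X x ^+ 2)%:E = z%:E ->
  ~ {ae P, forall x, X x = m} -> (m ^+ 2 < z)%R.
Proof.
move=> mX X0 Xm Xz XNcst.
have m0 : (0 <= m)%R.
  by rewrite -lee_fin -Xm integral_ge0// => x _; rewrite lee_fin.
have mX2 : measurable_fun [set: T] (fun x => (X x ^+ 2)%:E).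
  by apply/measurable_EFinP; exact: measurable_funX.
have mXm : measurable_fun [set: T] (fun x => ((X x - m) ^+ 2)%:E).
  by apply/measurable_EFinP; apply: measurable_funX; exact: measurable_funB.
have mmX : measurable_fun [set: T] (fun x => (2 * m)%:E * (X x)%:E).
  by apply: measurable_funeM; exact/measurable_EFinP.
(* The cross term of the expanded square is moved to the left, so that all integrands are
   nonnegative and additivity applies without any integrability proof. *)
have : \int[P]_x (((X x - m) ^+ 2)%:E + (2 * m)%:E * (X x)%:E) =
       \int[P]_x ((X x ^+ 2)%:E + (m ^+ 2)%:E).
  by apply: eq_integral => x _; rewrite -EFinM -!EFinD; congr EFin; ring.
rewrite ge0_integralD//; last 2 first.
- by move=> x _; rewrite lee_fin sqr_ge0.
- by move=> x _; rewrite mule_ge0// lee_fin ?mulr_ge0.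
rewrite ge0_integralD//; last 2 first.
- by move=> x _; rewrite lee_fin sqr_ge0.
- by move=> x _; rewrite lee_fin sqr_ge0.
rewrite ge0_integralZl_EFin ?mulr_ge0//; last 2 first.
- by move=> x _; rewrite lee_fin.
- exact/measurable_EFinP.
rewrite integral_cst//= probability_setT mule1 Xm Xz => V.
(* [V] says that the variance plus 2 m^2 equals z + m^2, so z <= m^2 forces the variance to be 0. *)
rewrite ltNge; apply/negP => zm; apply: XNcst.
have /(ae_eq_integral_abs P measurableT mXm).1 :
    \int[P]_x `|((X x - m) ^+ 2)%:E| = 0.
  under eq_integral do rewrite gee0_abs ?lee_fin ?sqr_ge0//.
  have : 0 <= \int[P]_x ((X x - m) ^+ 2)%:E.
    by apply: integral_ge0 => x _; rewrite lee_fin sqr_ge0.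
  move: V; case: (\int[P]_x _) => [v| |]//; rewrite -EFinM -!EFinD lee_fin.
  by move=> [vE] v0; congr EFin; nra.
apply: filterS => x /(_ I) /eqP; rewrite eqe sqrf_eq0 subr_eq0.
by move/eqP.
Qed.

(** * Tempered likelihood ratios, for a positive real-valued density [f] *)

Section tempering.
Context {d : measure_display} {T : measurableType d} {R : realType}.

Lemma mule_lambda (P0 : probability T R) (r : T -> \bar R) b : (0 < b)%R ->
  b%:E * lambda P0 r b = - lne (Z P0 r b).
Proof.
by move=> b0; rewrite /lambda muleN muleA -EFinM divff ?mul1e ?gt_eqF.
Qed.

Lemma Z1 (P0 P1 : probability T R) (r : T -> \bar R) :
  is_density P0 P1 r -> Z P0 r 1 = 1.
Proof.
move=> [mr r0 rE]; rewrite /Z -[RHS](probability_setT P1) rE//.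
by apply: eq_integral => x _; rewrite poweRe1.
Qed.

Variables (P0 P1 : probability T R) (f : T -> R).
Hypotheses (mf : measurable_fun [set: T] f) (f_gt0 : forall x, (0 < f x)%R).
Hypothesis fE : is_density P0 P1 (EFin \o f).

Let mpow a : measurable_fun [set: T] (fun x => (f x `^ a)%:E).
Proof.
apply/measurable_EFinP.
exact: (@measurableT_comp _ _ _ _ _ _ (@powR R ^~ a)).
Qed.

Let pow_ge0 a x : 0 <= (f x `^ a)%:E.
Proof. by rewrite lee_fin powR_ge0. Qed.

Let mean_f : \int[P0]_x (f x)%:E = 1.
Proof.
by rewrite -(Z1 fE); apply: eq_integral => x _; rewrite /= powRr1// ltW.
Qed.

(** The bridge between exponents [s] under P1 and 1 - s under P0: f^(-s) f = f^(1-s). *)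
Lemma integral_powR_density s :
  \int[P1]_x (f x `^ (- s))%:E = Z P0 (EFin \o f) (1 - s).
Proof.
rewrite (ge0_integral_density fE)//; apply: eq_integral => x _.
rewrite /= -EFinM addrC powRD; last by rewrite [f x == _]gt_eqF ?implybT.
by rewrite powRr1 ?ltW.
Qed.

(* Bernoulli: f^-t >= 1 - t (f - 1), and f has mean 1 under P0. *)
Lemma Z_npos_ge1 (t : R) : (0 <= t)%R -> 1 <= Z P0 (EFin \o f) (- t).
Proof.
(* Combines exp(y) >= 1 + y at y = -t ln f with ln f <= f - 1. The term t f stands on the right to
   keep both integrands nonnegative. *)
move=> t0; have h x : ((1 + t)%:E <= (f x `^ (- t))%:E + t%:E * (f x)%:E).
  rewrite -EFinM -EFinD lee_fin /powR gt_eqF//.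
  have := expR_ge1Dx (- t * ln (f x)); have := ln_sublinear (f_gt0 x).
  have : (ln (f x) <= f x - 1)%R.
    by rewrite -{1}[f x](subrK 1%R) addrC le_ln1Dx// ltrBrDr addNr.
  by move=> + _ +; nra.
have mft : measurable_fun [set: T] (fun x => t%:E * (f x)%:E).
  by apply: measurable_funeM; exact/measurable_EFinP.
have : \int[P0]_x (1 + t)%:E <=
    \int[P0]_x ((f x `^ (- t))%:E + t%:E * (f x)%:E).
  apply: ge0_le_integral => //.
  - by move=> x _; rewrite lee_fin addr_ge0.
  - exact: emeasurable_funD.
rewrite integral_cst//= probability_setT mule1 ge0_integralD//; last first.
  by move=> x _; rewrite mule_ge0 ?lee_fin// ltW.
rewrite ge0_integralZl_EFin//; last 2 first.
- by move=> x _; rewrite lee_fin ltW.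
- exact/measurable_EFinP.
by rewrite mean_f mule1 EFinD leeD2rE.
Qed.

(** Pointwise f^b <= 1 + f, by separating f <= 1 from f >= 1, and the bound has mean 2. *)
Lemma Z_lty (b : R) : (0 <= b <= 1)%R -> Z P0 (EFin \o f) b < +oo.
Proof.
move=> /andP[b0 b1].
have h x : (f x `^ b)%:E <= 1%:E + (f x)%:E.
  rewrite -EFinD lee_fin; have [f1|/ltW f1] := leP (f x) 1%R.
    rewrite -[leLHS]addr0 lerD ?(ltW (f_gt0 x))//.
    apply: (@le_trans _ _ (1 `^ b)%R); last by rewrite powR1.
    by rewrite ge0_ler_powR// nnegrE// ltW.
  by rewrite (le_trans (ler1_powR f1 b1))// lerDr.
have : Z P0 (EFin \o f) b <= \int[P0]_x (1%:E + (f x)%:E).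
  apply: ge0_le_integral => //.
  - by move=> x _; exact: pow_ge0.
  - exact: mpow.
  - by apply: emeasurable_funD => //; exact/measurable_EFinP.
  - by move=> x _; exact: h.
move/le_lt_trans; apply.
rewrite ge0_integralD//; last 2 first.
- by move=> x _; rewrite lee_fin ltW.
- exact/measurable_EFinP.
rewrite integral_cst//= probability_setT mul1e.
by rewrite mean_f -EFinD ltry.
Qed.

(** A zero integral would make the positive function f^b vanish almost surely, so that the whole
    space would be null. *)
Lemma Z_gt0 b : 0 < Z P0 (EFin \o f) b.
Proof.
rewrite lt0e integral_ge0 ?andbT; last by move=> x _; exact: pow_ge0.
apply/negP => /eqP Z0.
have /(ae_eq_integral_abs P0 measurableT (mpow b)).1 :
    \int[P0]_x `|(f x `^ b)%:E| = 0.
  by rewrite -Z0; apply: eq_integral => x _; rewrite gee0_abs.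
move=> [N [mN N0 sN]].
have : P0 N = 1.
  rewrite (_ : N = setT) ?probability_setT//.
  apply/seteqP; split => // x _; apply: sN => /(_ I) /eqP.
  by rewrite eqe gt_eqF// powR_gt0.
by rewrite N0 => /esym/eqP; rewrite onee_eq0.
Qed.

Lemma Lambda_density : Lambda P1 (EFin \o f) =
  ereal_sup [set b%:E * lambda P0 (EFin \o f) b | b in `]0%R, 1%R]].
Proof.
have LE s : - lne (\int[P1]_x npow (f x)%:E s) =
    - lne (Z P0 (EFin \o f) (1 - s)).
  congr (- lne _); rewrite -integral_powR_density.
  by apply: eq_integral => x _; rewrite npow_EFin.
apply/eqP; rewrite eq_le; apply/andP; split; apply: ge_ereal_sup => _ [s + <-].
- rewrite /= in_itv/= andbT => s0; rewrite LE; have [s1|s1] := ltP s 1%R.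
    apply: ereal_sup_ubound; exists (1 - s)%R; last first.
      by rewrite mule_lambda ?subr_gt0.
    by rewrite /= in_itv/= subr_gt0 s1 gerBl.
  (* For s >= 1 the value is at most 0, which the right-hand side attains at beta = 1 because Z_1 =
     1. *)
  apply: (@le_trans _ _ 0).
    rewrite oppe_le0 lne_ge0 -opprB; apply: Z_npos_ge1.
    by rewrite subr_ge0.
  apply: ereal_sup_ubound; exists 1%R; first by rewrite /= in_itv/= ltr01 lexx.
  by rewrite mule_lambda// (Z1 fE) lne1 oppe0.
- rewrite /= in_itv/= => /andP[s0 s1]; rewrite mule_lambda//.
  apply: ereal_sup_ubound; exists (1 - s)%R.
    by rewrite /= in_itv/= subr_ge0 s1.
  by rewrite LE; congr (- lne (Z _ _ _)); rewrite opprB addrC subrK.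
Qed.

(** [sqr_mean_lt] for f^(b/2), whose mean is Z_(b/2) and whose second moment is Z_b. Were f^(b/2)
    almost surely constant, taking the power 2/b would make [f] so. *)
Lemma Z_half_lt b : (0 < b <= 1)%R ->
  ~ (exists c, {ae P0, forall x, f x = c}) ->
  (fine (Z P0 (EFin \o f) (b / 2)) ^+ 2 < fine (Z P0 (EFin \o f) b))%R.
Proof.
move=> /andP[b0 b1] fNcst.
have ZE a : (0 <= a <= 1)%R ->
    Z P0 (EFin \o f) a = (fine (Z P0 (EFin \o f) a))%:E.
  by move=> a01; rewrite fineK// ge0_fin_numE ?Z_lty// ltW// Z_gt0.
have b2 : (0 <= b / 2 <= 1)%R by apply/andP; split; lra.
have b20 : (b / 2 != 0)%R by rewrite gt_eqF// divr_gt0.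
apply: (@sqr_mean_lt _ _ _ P0 (fun x => f x `^ (b / 2))%R).
- exact/measurable_EFinP/mpow.
- by move=> x; exact: powR_ge0.
- by rewrite -ZE.
- rewrite -ZE ?b1 ?ltW//; apply: eq_integral => x _.
  by rewrite -powR_mulrn ?powR_ge0// -powRrM mulrVK ?unitfE ?pnatr_eq0.
- move=> fcst; apply: fNcst.
  exists (fine (Z P0 (EFin \o f) (b / 2)) `^ (b / 2)^-1)%R.
  move: fcst; apply: filterS => x <-.
  by rewrite -powRrM divff// powRr1 ?ltW.
Qed.

(* The witness is s = 1/b - 1/2: it gives the value lambda b plus
   (log Z_b) / 2 - log Z_(b/2), which is positive by Jensen's inequality. *)
Lemma lambda_lt_Lambda_density b : (0 < b <= 1)%R ->
  ~ (exists c, {ae P0, forall x, f x = c}) ->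
  lambda P0 (EFin \o f) b < Lambda P1 (tempered P0 (EFin \o f) b).
Proof.
move=> b01 fNcst; have /andP[b0 b1] := b01.
have := Z_half_lt b01 fNcst.
have ZE a : (0 <= a <= 1)%R -> exists2 z, (0 < z)%R & Z P0 (EFin \o f) a = z%:E.
  move=> a01; exists (fine (Z P0 (EFin \o f) a)).
    by rewrite fine_gt0// Z_gt0 Z_lty.
  by rewrite fineK// ge0_fin_numE ?Z_lty// ltW// Z_gt0.
have [z z0 Zb] : exists2 z, (0 < z)%R & Z P0 (EFin \o f) b = z%:E.
  by apply: ZE; rewrite b1 ltW.
have [m m0 Zb2] : exists2 m, (0 < m)%R & Z P0 (EFin \o f) (b / 2) = m%:E.
  by apply: ZE; apply/andP; split; lra.
rewrite Zb Zb2/= => mz.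
pose s := (b^-1 - 2^-1)%R.
have bs : (b * s = 1 - b / 2)%R by rewrite mulrBr divff// gt_eqF.
have s0 : (0 <= s)%R.
  by rewrite subr_ge0 lef_pV2 ?posrE//; lra.
(* E_P1[R_b^(-s)] = Z_b^s E_P1[f^(-b s)] = Z_b^s Z_(1 - b s), and b s = 1 - b/2 turns the last
   factor into Z_(b/2) = m. *)
apply: (@lt_le_trans _ _ (- lne (z `^ s * m)%:E)); last first.
  apply: ereal_sup_ubound; exists s; first by rewrite /= in_itv/= s0.
  congr (- lne _); rewrite EFinM -Zb2 -[(b / 2)%R](subKr 1%R) -bs.
  rewrite -integral_powR_density -ge0_integralZl_EFin ?powR_ge0//.
  apply: eq_integral => x _; rewrite /tempered Zb inver gt_eqF//.
  rewrite /= -EFinM npow_EFin ?divr_gt0 ?powR_gt0//.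
  rewrite powRM ?powR_ge0 ?invr_ge0 ?ltW// -powRrM mulrN -EFinM mulrC.
  by congr (_ * _)%:E; rewrite -powR_inv1 ?ltW// -powRrM mulN1r opprK.
rewrite lne_EFin ?mulr_gt0 ?powR_gt0// lnM ?posrE ?powR_gt0// ln_powR.
(* The terms (1/b) ln z cancel, leaving ln m < (ln z) / 2. *)
rewrite /lambda Zb lne_EFin// -EFinM -!EFinN lte_fin ltrN2 mulrBl.
have : (ln (m ^+ 2) < ln z)%R by rewrite ltr_ln ?posrE ?exprn_gt0.
rewrite lnXn// -mulr_natr; lra.
Qed.

End tempering.

(** * The Chernoff integral as a moment of R *)

Section chernoff.
Context {d : measure_display} {T : measurableType d} {R : realType}.

Lemma chernoff_integral (mu : {measure set T -> \bar R})
    (P0 P1 : probability T R) (r p0 p1 : T -> \bar R) (b : R) :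
  is_density P0 P1 r -> is_density mu P0 p0 -> is_density mu P1 p1 ->
  (0 < b)%R -> \int[mu]_x (p0 x `^ (1 - b) * p1 x `^ b) = Z P0 r b.
Proof.
move=> rP1 p0P0 p1P1 b_gt0.
have [mr r0 _] := rP1; have [mp0 p0_ge0 _] := p0P0; have [mp1 p1_ge0 _] := p1P1.
rewrite /Z (ge0_integral_density p0P0); last 2 first.
- exact: measurable_fun_poweR.
- by move=> x; exact: poweR_ge0.
apply: ge0_ae_eq_integral => //.
- by apply: emeasurable_funM; exact: measurable_fun_poweR.
- by apply: emeasurable_funM => //; exact: measurable_fun_poweR.
- by move=> x _; rewrite mule_ge0 ?poweR_ge0.
- by move=> x _; rewrite mule_ge0 ?poweR_ge0.
have P1T : P1 [set: T] < +oo by rewrite probability_setT ltry.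
(* Both [p1] and r p0 are densities of P1 with respect to [mu], so they agree almost everywhere. *)
have := is_density_ae_unique P1T p1P1 (is_density_comp rP1 p0P0).
apply: filterS => x /(_ I) -> _.
rewrite poweRM// muleCA -poweRD ?subrK ?poweRe1//.
(* The exponents 1 - b and b have the nonzero sum 1, so they may be added even where [p0] is 0 or
   +oo. *)
by apply: add_neq0_poweRD_def; rewrite subrK oner_eq0.
Qed.

End chernoff.

(** * Transfer from the positive real version back to R *)

Theorem corollary4p18 (d : measure_display) (T : measurableType d)
    (R : realType) (P0 P1 : probability T R) (r : T -> \bar R) :
  P1 `<< P0 ->
  KL P1 P0 < +oo ->
  KL P0 P1 < +oo ->
  is_density P0 P1 r ->
  [/\ Lambda P1 r = ereal_sup [set b%:E * lambda P0 r b | b in `]0%R, 1%R]],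
      ereal_sup [set b%:E * lambda P0 r b | b in `]0%R, 1%R]] =
        - ereal_inf [set lne (Z P0 r b) | b in `]0%R, 1%R]] &
      forall (mu : {measure set T -> \bar R}) (p0 p1 : T -> \bar R),
        is_density mu P0 p0 -> is_density mu P1 p1 ->
        - ereal_inf [set lne (Z P0 r b) | b in `]0%R, 1%R]] =
          chernoff_information mu p0 p1]
  /\
  ((~ exists c : \bar R, {ae P0, forall x, lne (r x) = c}) ->
   forall b : R, (0 < b <= 1)%R ->
     lambda P0 r b < Lambda P1 (tempered P0 r b)).
Proof.
move=> P10 _ /KL_lty_dominates P01 rP1; have [mr r0 _] := rP1.
have [f [mf f_gt0 rf]] := pos_density_version P01 rP1.
have mEf : measurable_fun [set: T] (EFin \o f) by exact/measurable_EFinP.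
have fP1 : is_density P0 P1 (EFin \o f).
  by apply: is_density_ae_eq rf => // x; rewrite lee_fin ltW.
(* [Lambda] integrates against P1, so the P0-almost sure equality is carried over by P1 << P0. *)
have rf1 : ae_eq P1 [set: T] r (EFin \o f) by exact: null_dominates_ae_eq rf.
have ZE b : Z P0 r b = Z P0 (EFin \o f) b by exact: ae_eq_Z.
have lambdaE b : lambda P0 r b = lambda P0 (EFin \o f) b by rewrite /lambda ZE.
split; first split.
- rewrite (ae_eq_Lambda mr mEf rf1) (Lambda_density mf f_gt0 fP1).
  by congr ereal_sup; apply: eq_imagel => b _; rewrite lambdaE.
- rewrite -ereal_supN image_comp; congr ereal_sup; apply: eq_imagel => b.
  by rewrite /= in_itv/= => /andP[b0 _]; rewrite mule_lambda.
- move=> mu p0 p1 p0P0 p1P1; congr (- _); apply/eqP; rewrite eq_le.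
  apply/andP; split; apply: le_ereal_inf_tmp => _ [b + <-]; rewrite /= in_itv/=.
    move=> /andP[]; rewrite le_eqVlt => /predU1P[<- _|b0 b1]; last first.
      rewrite (chernoff_integral rP1)//.
      by apply: ereal_inf_lbound; exists b => //=; rewrite in_itv/= b0.
    (* At beta = 0 the integrand is [p0], since x^0 = 1 also at 0 and +oo; its integral 1 equals
       Z_1, so the closed endpoint does not lower the infimum. *)
    apply: ereal_inf_lbound; exists 1%R.
      by rewrite /= in_itv/= ltr01 lexx.
    have [_ p0_ge0 p0E] := p0P0.
    congr lne; rewrite (Z1 rP1) -[LHS](probability_setT P0) p0E//.
    by apply: eq_integral => x _; rewrite subr0 poweRe1// poweRe0 mule1.
  move=> /andP[b0 b1]; apply: ereal_inf_lbound; exists b.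
    by rewrite /= in_itv/= ltW.
  by rewrite (chernoff_integral rP1).
- move=> rNcst b b01; rewrite lambdaE.
  have mtemp (g : T -> \bar R) : measurable_fun [set: T] g ->
      measurable_fun [set: T] (fun x => g x `^ b / Z P0 (EFin \o f) b).
    by move=> mg; apply: emeasurable_funM => //; exact: measurable_fun_poweR.
  rewrite (_ : Lambda P1 (tempered P0 r b) =
      Lambda P1 (tempered P0 (EFin \o f) b)).
    apply: (lambda_lt_Lambda_density mf f_gt0 fP1 b01) => -[c fc].
    (* A constant value c of [f] would make log r almost surely equal to log c. *)
    apply: rNcst; exists (lne c%:E); move: fc rf; apply: filterS2.
    by move=> x <- /(_ I) ->.
  rewrite /tempered ZE; apply: ae_eq_Lambda; [exact: mtemp..|].
  exact: (ae_eq_comp (fun y => y `^ b / Z P0 (EFin \o f) b)).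
Qed.
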